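(* Let $$q(z)=\sum_{k=1}^K\frac{w_k}{z-z_k},\qquad\sum_{k=1}^K|w_k|^2=1,$$ be given in barycentric form with $|z_k|=\mathcal{O}(1)$ for all $1\le k\le K$. Let $\widehat\lambda$ be a computed generalized eigenvalue, from a backward stable method, of the $(K+1)\times(K+1)$ matrix pencil $A-\lambda B$ with $$A=\begin{bmatrix}0&w_1&w_2&\cdots&w_K\\1&z_1&&&\\1&&z_2&&\\\vdots&&&\ddots&\\1&&&&z_K\end{bmatrix},\qquad B=\begin{bmatrix}0&&&&\\&1&&&\\&&1&&\\&&&\ddots&\\&&&&1\end{bmatrix}.$$ If there exists an integer $\widehat k$ such that $1\le\widehat k\le K$ and $$\min_{1\le k\ne\widehat k\le K}|\widehat\lambda-z_k|=\Theta(1),$$ then $\widehat\lambda$ is a backward stable root of $q$.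
   Context: $z_1,\dots,z_K\in\mathbb{C}$ are support points and $w_1,\dots,w_K\in\mathbb{C}$ are (normalized) weights. $\mathbf{u}$ is the machine precision (unit roundoff). $a=\mathcal{O}(b)$ means $|a|\le c|b|$, and $a=\Theta(b)$ means $c_1|b|\le|a|\le c_2|b|$, for some positive constants $c,c_1,c_2$. The roots of $q$ can be recovered as the finite generalized eigenvalues of the pencil $A-\lambda B$. The generalized eigenvalues of $A-\lambda B$ are computed by a backward stable method (such as the QZ algorithm) if the computed eigenvalues are the exact eigenvalues of $(A+\Delta A)-\lambda(B+\Delta B)$ for small perturbations $\Delta A,\Delta B$, i.e. of norm $\mathcal{O}(\mathbf{u})$. A computed root $\widehat\lambda$ of $q$ is called (backward) stable if there exist $\widehat w_k$, $1\le k\le K$, satisfying $|w_k-\widehat w_k|=\mathcal{O}(\mathbf{u})$, such that $\widehat q(\widehat\lambda):=\sum_{k=1}^K\frac{\widehat w_k}{\widehat\lambda-z_k}=0$.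
   Formalization: The computed eigenvalue is additionally assumed to differ from every support point z_k, since otherwise the perturbed sum is undefined at it; e.g. K=2, z=(0,1), w=(0,1) has exact eigenvalue 0, where no O(u)-perturbed weights give a root. *)

(* Defs.v *)
From HB Require Import structures.
From mathcomp Require Import all_boot all_order all_algebra.
From mathcomp Require Import complex.
From mathcomp Require Import all_classical all_reals all_analysis.

Set Implicit Arguments.
Unset Strict Implicit.
Unset Printing Implicit Defensive.

Import Order.TTheory GRing.Theory Num.Theory.
Import numFieldNormedType.Exports.

Local Open Scope ring_scope.
Local Open Scope complex_scope.

(* In R[i] the library norm is R[i]-valued; this is the modulus as a real. *)
Definition modulus (R : realType) (x : R[i]) : R := complex.Re `|x|.

Section Barycentric.
Variables (R : realType) (K : nat).
Implicit Types (w z : 'rV[R[i]]_K) (x : R[i]).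

(* Meaningful only when x is not one of the z_k: division by 0 returns 0. *)
Definition bary w z x : R[i] := \sum_(k < K) w 0 k / (x - z 0 k).

Definition pencilA w z : 'M[R[i]]_(1 + K) :=
  block_mx 0 w (const_mx 1) (diag_mx z).

Definition pencilB : 'M[R[i]]_(1 + K) := block_mx 0 0 0 1%:M.

(* The minimum over an empty index set is +oo. *)
Definition min_dist_except z (k0 : 'I_K) x : \bar R :=
  \big[Order.min/+oo%E]_(k < K | k != k0) (modulus (x - z 0 k))%:E.

(* |w_k - w'_k| <= c * u is the bound O(u) with explicit constant c. *)
Definition backward_stable_root (c u : R) w z x : Prop :=
  exists w' : 'rV[R[i]]_K,
    (forall k : 'I_K, modulus (w 0 k - w' 0 k) <= c * u) /\ bary w' z x = 0.

End Barycentric.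

Definition generalized_eigenvalue (F : fieldType) (n : nat) (A B : 'M[F]_n)
    (x : F) : Prop :=
  exists2 v : 'cV[F]_n, v != 0 & A *m v = x *: (B *m v).

(* The matrix norm is the library's (largest modulus of an entry). As n is
   fixed before the constants, any other norm only rescales c. *)
Definition backward_stably_computed (R : realType) (n : nat) (c u : R)
    (A B : 'M[R[i]]_n) (x : R[i]) : Prop :=
  exists dA dB : 'M[R[i]]_n,
    [/\ complex.Re (mx_norm dA) <= c * u,
        complex.Re (mx_norm dB) <= c * u
      & generalized_eigenvalue (A + dA) (B + dB) x].

(* Main.v *)
(** Only the weight at [khat] is perturbed: with [d = lambda - z khat], replacing
    [w khat] by [w khat - d * q(lambda)] makes [lambda] a root, so everything
    reduces to [|d * q(lambda)| = O(u)].  An eigenvector [(v0, x)] of the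
    perturbed pencil, scaled to have largest entry of modulus 1, satisfies the
    equations of the unperturbed pencil up to residuals of size [e = O(u)].
    These give [|v0| |d q(lambda)| = O(e) (|d| + |w khat|)], while the scaling
    forces [|d| + |w khat| = O(|v0| + e)].  If [e <= |v0|], divide by [|v0|];
    otherwise [d] and [w khat] are themselves [O(e)], hence so is
    [d q(lambda) = w khat + d * O(1)]. *)
Require Import Defs.
From HB Require Import structures.
From mathcomp Require Import all_boot all_order all_algebra.
From mathcomp Require Import complex.
From mathcomp Require Import all_classical all_reals all_analysis.
From mathcomp Require Import ring lra.

Import Order.TTheory GRing.Theory Num.Theory.
Import numFieldNormedType.Exports.

Local Open Scope ring_scope.
Local Open Scope complex_scope.

(** * The real-valued modulus on [R[i]] *)

Lemma modulus_ge0 (R : realType) (x : R[i]) : 0 <= modulus x.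
Proof. by rewrite /modulus normc_def /= sqrtr_ge0. Qed.

Lemma modulusM (R : realType) (x y : R[i]) :
  modulus (x * y) = modulus x * modulus y.
Proof. exact: Normc.normcM. Qed.

Lemma modulusV (R : realType) (x : R[i]) : modulus x^-1 = (modulus x)^-1.
Proof. exact: Normc.normcV. Qed.

Lemma ler_modulusD (R : realType) (x y : R[i]) :
  modulus (x + y) <= modulus x + modulus y.
Proof. exact: le_normcD. Qed.

Lemma modulusN (R : realType) (x : R[i]) : modulus (- x) = modulus x.
Proof. exact: normcN. Qed.

Lemma modulus0 (R : realType) : modulus (0 : R[i]) = 0.
Proof. exact: Normc.normc0. Qed.

Lemma modulus1 (R : realType) : modulus (1 : R[i]) = 1.
Proof. exact: Normc.normc1. Qed.

Lemma modulus_gt0 (R : realType) (x : R[i]) : x != 0 -> 0 < modulus x.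
Proof.
move=> x0; rewrite lt_neqAle modulus_ge0 andbT eq_sym.
by apply: contra_neq x0 => /Normc.eq0_normc.
Qed.

Lemma ler_modulus_sum (R : realType) (I : finType) (P : pred I) (F : I -> R[i]) :
  modulus (\sum_(i | P i) F i) <= \sum_(i | P i) modulus (F i).
Proof.
elim/big_rec2: _ => [|i y x _ le_xy]; first by rewrite modulus0.
by rewrite (le_trans (ler_modulusD _ _ _)) // lerD2l.
Qed.

Lemma ler_modulus_sum_const (R : realType) (n : nat) (P : pred 'I_n)
    (F : 'I_n -> R[i]) (b : R) :
  0 <= b -> (forall i, P i -> modulus (F i) <= b) ->
  modulus (\sum_(i | P i) F i) <= n%:R * b.
Proof.
move=> b0 leF; apply: le_trans (ler_modulus_sum _ _ _ _) _.
apply: le_trans (ler_sum _ leF) _.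
rewrite sumr_const -[leLHS]mulr_natl ler_wpM2r // ler_nat.
by rewrite -[leqRHS]card_ord max_card.
Qed.

Lemma modulus_le_mx_norm (R : realType) (m n : nat) (A : 'M[R[i]]_(m, n)) i j :
  modulus (A i j) <= complex.Re (mx_norm A).
Proof.
have : `|A i j| <= mx_norm A.
  rewrite mx_normE -[leLHS]nngE num_le.
  exact: (le_bigmax _ (fun ij => `|A ij.1 ij.2|%:nng) (i, j)).
(* The order of [R[i]] compares real parts of numbers with equal imaginary part. *)
by rewrite lecE => /andP[].
Qed.

(** * From an approximate eigenvector to a bound on the scaled value of [q] *)

Section RootResidual.
Variables (R : realType) (K : nat) (w z : 'rV[R[i]]_K) (lambda : R[i]).
Variables (m : 'I_K) (c1 D : R).
Hypothesis c1_gt0 : 0 < c1.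
Hypothesis w_le1 : forall k, modulus (w 0 k) <= 1.
Hypothesis lambda_neq : forall k, lambda != z 0 k.
Hypothesis far : forall k, k != m -> c1 <= modulus (lambda - z 0 k).
Hypothesis near_m : modulus (lambda - z 0 m) <= D.
(** [(v0, x)] plays the scaled eigenvector; [row0] and [rowS] bound the rows of its residual in the
    unperturbed pencil. *)
Variables (v0 : R[i]) (x : 'I_K -> R[i]) (e : R).
Hypothesis e_gt0 : 0 < e.
Hypothesis v_normalized : modulus v0 = 1 \/ exists k, modulus (x k) = 1.
Hypothesis row0 : modulus (\sum_k w 0 k * x k) <= e.
Hypothesis rowS : forall k, modulus (v0 - (lambda - z 0 k) * x k) <= e.

Local Notation d k := (lambda - z 0 k).
Local Notation G := ((1 + D) * (1 + c1^-1) + 2 + K%:R / c1).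

Let d_neq0 k : d k != 0. Proof. by rewrite subr_eq0. Qed.

Let ci_gt0 : 0 < c1^-1. Proof. by rewrite invr_gt0. Qed.

Let di_le k : k != m -> modulus (d k)^-1 <= c1^-1.
Proof.
by move=> /far ck; rewrite modulusV lef_pV2 ?posrE // (lt_le_trans _ ck).
Qed.

Let dx_le k : modulus (d k * x k) <= modulus v0 + e.
Proof.
have -> : d k * x k = v0 + - (v0 - d k * x k) by ring.
by rewrite (le_trans (ler_modulusD _ _ _)) // lerD2l modulusN.
Qed.

Let x_le k : k != m -> modulus (x k) <= (modulus v0 + e) / c1.
Proof.
move=> km; have -> : x k = (d k * x k) * (d k)^-1 by field; exact: d_neq0.
by rewrite modulusM ler_pM ?modulus_ge0 ?di_le.
Qed.

(** The entry of modulus 1 can be [v0], some [x k] with [k != m], or [x m]. Each case yields one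
    summand of [G]: [1 + D], [(1 + D) / c1] and [2 + K / c1]. *)
Let node_weight_le :
  modulus (d m) + modulus (w 0 m) <= G * (modulus v0 + e).
Proof.
set P := modulus v0 + e; set H := K%:R / c1.
have P_gt0 : 0 < P by rewrite ltr_wpDl ?modulus_ge0.
have D_ge0 : 0 <= D := le_trans (modulus_ge0 _ _) near_m.
have H_ge0 : 0 <= H by rewrite mulr_ge0 ?ler0n ?ltW.
have sum_le : modulus (d m) + modulus (w 0 m) <= 1 + D.
  by rewrite addrC lerD.
have PG : (1 + D) * P + (1 + D) * (P / c1) + (2 + H) * P = G * P.
  by rewrite /H; ring.
have P_ge0 := ltW P_gt0.
have D1_ge0 : 0 <= 1 + D by rewrite addr_ge0.
have H2_ge0 : 0 <= 2 + H by rewrite addr_ge0.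
have t1 : 0 <= (1 + D) * P by rewrite mulr_ge0.
have t2 : 0 <= (1 + D) * (P / c1) by rewrite !mulr_ge0 // ltW.
have t3 : 0 <= (2 + H) * P by rewrite mulr_ge0.
rewrite -PG; case: v_normalized => [v1|[k xk1]].
  have P_ge1 : 1 <= P by rewrite /P v1 lerDl ltW.
  have : (1 + D) * 1 <= (1 + D) * P by rewrite ler_wpM2l.
  lra.
have [km|km] := eqVneq k m; last first.
  (* A unit entry at a far node forces [1 <= P / c1], so the crude bound [1 + D] suffices. *)
  have : (1 + D) * 1 <= (1 + D) * (P / c1).
    by rewrite ler_wpM2l // -xk1 x_le.
  lra.
rewrite {}km in xk1.
(* With [x m] of modulus 1, row [m] bounds [d m], and row 0 solved for [w m * x m] bounds [w m]. *)
have dm_le : modulus (d m) <= P by move: (dx_le m); rewrite modulusM xk1 mulr1.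
have wm_le : modulus (w 0 m) <= P + H * P.
  rewrite -[modulus (w 0 m)]mulr1 -xk1 -modulusM.
  have -> : w 0 m * x m =
      \sum_k w 0 k * x k + - \sum_(k | k != m) w 0 k * x k.
    by rewrite (bigD1 m) //= addrK.
  apply: le_trans (ler_modulusD _ _ _) _; rewrite modulusN lerD //.
    by apply: le_trans row0 _; rewrite lerDr modulus_ge0.
  have -> : H * P = K%:R * (P / c1) by rewrite /H; ring.
  apply: ler_modulus_sum_const => [|j jm].
    by rewrite mulr_ge0 ?(ltW ci_gt0).
  by rewrite modulusM -[leRHS]mul1r ler_pM ?modulus_ge0 ?x_le.
lra.
Qed.

(** The factor [d m] cancels the only denominator that may be small. *)
Let scaled_bary_eq : d m * bary w z lambda =
  w 0 m + d m * \sum_(k | k != m) w 0 k / d k.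
Proof.
by rewrite /bary (bigD1 m) //= mulrDr mulrCA mulfV ?mulr1.
Qed.

Lemma modulus_scaled_bary_le :
  modulus (d m * bary w z lambda) <= 2 * (1 + K%:R / c1) * G * e.
Proof.
set H := K%:R / c1; set q := d m * _.
have H_ge0 : 0 <= H by rewrite mulr_ge0 ?ler0n ?ltW.
have dm0 := modulus_ge0 _ (d m); have wm0 := modulus_ge0 _ (w 0 m).
have v00 := modulus_ge0 _ v0.
set g := (_ + 2 + H).
have GP : modulus (d m) + modulus (w 0 m) <= g * (modulus v0 + e).
  exact: node_weight_le.
have g_ge0 : 0 <= g.
  have : 0 <= g * (modulus v0 + e) by apply: le_trans GP; rewrite addr_ge0.
  by rewrite pmulr_lge0 // ltr_wpDl.
(* Used twice: with [y] the row residuals, and with [y] constantly 1. *)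
have quot_le (y : 'I_K -> R[i]) b : 0 <= b -> (forall k, modulus (y k) <= b) ->
    modulus (\sum_(k | k != m) w 0 k * y k / d k) <= H * b.
  move=> b0 yb; have -> : H * b = K%:R * (b / c1) by rewrite /H; ring.
  apply: ler_modulus_sum_const => [|k km].
    by rewrite mulr_ge0 ?(ltW ci_gt0).
  rewrite !modulusM ler_pM ?mulr_ge0 ?modulus_ge0 ?di_le //.
  by rewrite -[leRHS]mul1r ler_pM ?modulus_ge0.
have [v_ge|v_lt] := lerP e (modulus v0).
  (* Elimination of [x]: with [r k = v0 - d k * x k], one has [v0 / d k = x k + r k / d k]. Summing
     against [w k] leaves only residuals; the factor [d m] turns the term [k = m] into
     [w m * r m]. *)
  have v0q : v0 * q = d m * (\sum_k w 0 k * x k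
      + \sum_(k | k != m) w 0 k * (v0 - d k * x k) / d k)
      + w 0 m * (v0 - d m * x m).
    rewrite /q scaled_bary_eq [\sum_k _](bigD1 m) //= mulrDr [v0 * (d m * _)]mulrCA.
    rewrite mulr_sumr -addrA -big_split /=.
    have -> : \sum_(k | k != m)
        (w 0 k * x k + w 0 k * (v0 - d k * x k) / d k) =
        \sum_(k | k != m) v0 * (w 0 k / d k).
      by apply: eq_bigr => k _; field; exact: d_neq0.
    ring.
  have v0q_le : modulus v0 * modulus q <=
      (1 + H) * e * (modulus (d m) + modulus (w 0 m)).
    rewrite -modulusM v0q; apply: le_trans (ler_modulusD _ _ _) _.
    rewrite [leRHS]mulrDr lerD // modulusM mulrC ler_wpM2r //.
      rewrite mulrDl mul1r; apply: le_trans (ler_modulusD _ _ _) _.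
      by rewrite lerD ?quot_le // ltW.
    by rewrite (le_trans (rowS m)) // mulrDl mul1r lerDl mulr_ge0 ?(ltW e_gt0).
  have v_gt0 : 0 < modulus v0 by apply: lt_le_trans v_ge.
  rewrite -(ler_pM2l v_gt0); apply: le_trans v0q_le _.
  (* The factor 2 comes from [|v0| + e <= 2 |v0|] here, and from [|v0| + e <= 2 e] in the other
     case. *)
  have -> : modulus v0 * (2 * (1 + H) * g * e) =
      (1 + H) * e * (g * (modulus v0 + modulus v0)) by ring.
  rewrite ler_wpM2l ?mulr_ge0 ?addr_ge0 ?(ltW e_gt0) //.
  by rewrite (le_trans GP) // ler_wpM2l // lerD2l.
rewrite /q scaled_bary_eq; apply: (@le_trans _ _
    ((1 + H) * (modulus (d m) + modulus (w 0 m)))).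
  apply: le_trans (ler_modulusD _ _ _) _; rewrite modulusM.
  have S_le : modulus (\sum_(k | k != m) w 0 k / d k) <= H.
    rewrite -[H]mulr1; under eq_bigr => k _ do rewrite -[w 0 k]mulr1.
    by apply: (quot_le (fun=> 1)) => // _; rewrite modulus1.
  have : modulus (d m) * modulus (\sum_(k | k != m) w 0 k / d k) <=
    modulus (d m) * H by rewrite ler_wpM2l.
  have : 0 <= H * modulus (w 0 m) by rewrite mulr_ge0.
  lra.
have -> : 2 * (1 + H) * g * e = (1 + H) * (g * (e + e)) by ring.
rewrite ler_wpM2l ?addr_ge0 // (le_trans GP) // ler_wpM2l // lerD2r.
exact: ltW.
Qed.

End RootResidual.

(** * Residuals of the computed eigenpair and the corrected weight *)

Lemma normalized_generalized_eigenvector (R : realType) (n : nat)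
    (A B : 'M[R[i]]_n) (lambda : R[i]) :
  generalized_eigenvalue A B lambda ->
  exists v : 'cV[R[i]]_n,
    [/\ forall i, modulus (v i 0) <= 1, exists i, modulus (v i 0) = 1
      & A *m v = lambda *: (B *m v)].
Proof.
case=> v v0 Av; have /cV0Pn[i0 vi0] := v0.
have [i _ imax] := arg_maxP (fun i => modulus (v i 0)) (erefl : xpredT i0).
have vi_gt0 : 0 < modulus (v i 0).
  by apply: lt_le_trans (imax i0 _) => //; exact: modulus_gt0.
(* Division by the largest entry is always possible, whereas the leading entry may vanish. *)
exists ((v i 0)^-1 *: v); split.
- move=> j; rewrite mxE modulusM modulusV mulrC ler_pdivrMr // mul1r.
  exact: imax.
- by exists i; rewrite mxE modulusM modulusV mulVf // gt_eqF.
- by rewrite -!scalemxAr Av !scalerA mulrC.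
Qed.

(** The residual equals [(lambda *: dB - dA) *m v]: each entry is a sum of [n] terms of modulus at
    most [b * (1 + L)]. *)
Lemma modulus_residual_le (R : realType) (n : nat) (A B dA dB : 'M[R[i]]_n)
    (lambda : R[i]) (v : 'cV[R[i]]_n) (b L : R) :
  complex.Re (mx_norm dA) <= b -> complex.Re (mx_norm dB) <= b -> 0 <= b ->
  modulus lambda <= L -> (forall i, modulus (v i 0) <= 1) ->
  (A + dA) *m v = lambda *: ((B + dB) *m v) ->
  forall i, modulus ((A *m v - lambda *: (B *m v)) i 0) <= n%:R * (b * (1 + L)).
Proof.
move=> dAb dBb b0 lamL v1 Ev i.
have L0 : 0 <= L := le_trans (modulus_ge0 _ _) lamL.
have -> : A *m v - lambda *: (B *m v) = (lambda *: dB - dA) *m v.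
  move: Ev; rewrite mulmxBl -scalemxAl !mulmxDl scalerDr => Ev.
  by apply/eqP; rewrite subr_eq addrAC eq_sym subr_eq Ev addrC.
rewrite mxE; apply: ler_modulus_sum_const => [|j _].
  by rewrite mulr_ge0 ?addr_ge0.
rewrite modulusM -[leRHS]mulr1 ler_pM ?modulus_ge0 //.
rewrite !mxE; apply: le_trans (ler_modulusD _ _ _) _.
rewrite modulusN modulusM addrC mulrDr mulr1 [b * L]mulrC lerD //.
  exact: le_trans (modulus_le_mx_norm _ _ _ _ _ _) _.
rewrite ler_pM ?modulus_ge0 //.
exact: le_trans (modulus_le_mx_norm _ _ _ _ _ _) _.
Qed.

Lemma pencil_residual_row0 (R : realType) (K : nat) (w z : 'rV[R[i]]_K)
    (lambda : R[i]) (v : 'cV[R[i]]_(1 + K)) :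
  (pencilA w z *m v - lambda *: (pencilB R K *m v)) (lshift K 0) 0 =
  \sum_k w 0 k * v (rshift 1 k) 0.
Proof.
rewrite -[v]vsubmxK /pencilA /pencilB !mul_block_col !mul0mx.
rewrite scale_col_mx opp_col_mx add_col_mx !col_mxEu !mxE addr0 mulr0 subr0 add0r.
by apply: eq_bigr => k _; rewrite col_mxEd.
Qed.

Lemma pencil_residual_rowS (R : realType) (K : nat) (w z : 'rV[R[i]]_K)
    (lambda : R[i]) (v : 'cV[R[i]]_(1 + K)) (k : 'I_K) :
  (pencilA w z *m v - lambda *: (pencilB R K *m v)) (rshift 1 k) 0 =
  v (lshift K 0) 0 - (lambda - z 0 k) * v (rshift 1 k) 0.
Proof.
rewrite -[v]vsubmxK /pencilA /pencilB !mul_block_col !mul0mx !add0r mul1mx.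
rewrite scale_col_mx opp_col_mx add_col_mx !col_mxEd !col_mxEu mul_diag_mx.
rewrite !mxE big_ord1 !mxE.
ring.
Qed.

(** In the barycentric sum the change of weight is divided by [lambda - z m], so it removes exactly
    [q(lambda)]. *)
Lemma bary_perturb_weight (R : realType) (K : nat) (w z : 'rV[R[i]]_K)
    (lambda : R[i]) (m : 'I_K) :
  lambda != z 0 m ->
  bary (w - ((lambda - z 0 m) * bary w z lambda) *: delta_mx 0 m) z lambda = 0.
Proof.
rewrite -subr_eq0 => d0; rewrite {1}/bary.
under eq_bigr => k _ do rewrite !mxE eqxx /= mulrBl.
rewrite sumrB -/(bary w z lambda) [X in _ - X](bigD1 m) //= eqxx mulr1 big1 => [|k km].
  by rewrite addr0 mulrAC mulfV // mul1r subrr.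
by rewrite (negbTE km) mulr0 mul0r.
Qed.

Theorem theorem4p3 (R : realType) (K : nat) (M cbe c1 c2 : R)
    (M_gt0 : 0 < M) (cbe_gt0 : 0 < cbe) (c1_gt0 : 0 < c1) (c2_gt0 : 0 < c2) :
  exists2 c : R, 0 < c &
    forall (u : R) (w z : 'rV[R[i]]_K) (lambda : R[i]),
      0 < u ->
      \sum_(k < K) modulus (w ord0 k) ^+ 2 = 1 ->
      (forall k : 'I_K, modulus (z ord0 k) <= M) ->
      backward_stably_computed cbe u (pencilA w z) (pencilB R K) lambda ->
      (forall k : 'I_K, lambda != z ord0 k) ->
      (exists khat : 'I_K,
         (c1%:E <= min_dist_except z khat lambda)%E /\
         (min_dist_except z khat lambda <= c2%:E)%E) ->
      backward_stable_root c u w z lambda.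
Proof.
(* [L] will bound [|lambda|], which lies within [c2] of some node, and [D] will bound
   [|lambda - z m|]. Then [c] is the factor of [modulus_scaled_bary_le] times the residual size for
   dimension [1 + K], with [u] taken out. *)
pose L := c2 + M; pose D := L + M.
pose G := (1 + D) * (1 + c1^-1) + 2 + K%:R / c1.
pose c := 2 * (1 + K%:R / c1) * G * ((1 + K)%:R * (cbe * (1 + L))).
have L_gt0 : 0 < L by rewrite addr_gt0.
have H_ge0 : 0 <= K%:R / c1 by rewrite mulr_ge0 ?invr_ge0 ?ler0n ?(ltW c1_gt0).
have ci_gt0 : 0 < c1^-1 by rewrite invr_gt0.
have L1_gt0 : 0 < 1 + L := addr_gt0 ltr01 L_gt0.
have D1_gt0 : 0 < 1 + D := addr_gt0 ltr01 (addr_gt0 L_gt0 M_gt0).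
have ci1_gt0 : 0 < 1 + c1^-1 := addr_gt0 ltr01 ci_gt0.
have G_gt0 : 0 < G by rewrite ltr_wpDr // addr_gt0 // mulr_gt0.
have c_gt0 : 0 < c.
  have H1_gt0 : 0 < 1 + K%:R / c1 by rewrite ltr_wpDr.
  by rewrite !mulr_gt0 ?ltr0n.
exists c => // u w z lambda u_gt0 w1 zM [dA [dB [dAu dBu eig]]] lamz [m [mlo mhi]].
have far k : k != m -> c1 <= modulus (lambda - z 0 k).
  by move=> km; move/bigmin_geP: mlo => [_ /(_ k km)]; rewrite lee_fin.
have lamL : modulus lambda <= L.
  (* The finite upper bound [c2] excludes the default value [+oo], so some node [k] other than [m]
     lies within [c2] of [lambda]. *)
  move/bigmin_leP: mhi => [|[k _]]; first by rewrite leye_eq.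
  rewrite lee_fin => kc2; rewrite -[lambda](subrK (z 0 k)).
  by rewrite (le_trans (ler_modulusD _ _ _)) // lerD.
have near_m : modulus (lambda - z 0 m) <= D.
  by rewrite (le_trans (ler_modulusD _ _ _)) // modulusN lerD.
have w_le1 k : modulus (w 0 k) <= 1.
  rewrite -(@ler_pXn2r _ 2) ?nnegrE ?modulus_ge0 // expr1n -w1 (bigD1 k) //=.
  by rewrite lerDl sumr_ge0 // => j _; rewrite exprn_ge0 ?modulus_ge0.
have [v [v1 [i vi1] Ev]] := normalized_generalized_eigenvector _ _ _ _ _ eig.
have b_ge0 : 0 <= cbe * u by rewrite mulr_ge0 ?ltW.
have res := modulus_residual_le _ _ _ _ _ _ _ _ _ _ dAu dBu b_ge0 lamL v1 Ev.
exists (w - ((lambda - z 0 m) * bary w z lambda) *: delta_mx 0 m).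
split; last exact: bary_perturb_weight.
set q := (_ - _) * _.
have q_le : modulus q <= c * u.
  have -> : c * u = 2 * (1 + K%:R / c1) * G * ((1 + K)%:R * (cbe * u * (1 + L))).
    by rewrite /c; ring.
  apply: (modulus_scaled_bary_le _ _ _ _ _ _ _ _ _ _ _ _ _
    (v (lshift K 0) 0) (fun k => v (rshift 1 k) 0)) => //.
  - by rewrite !mulr_gt0 ?ltr0n.
  (* The index of the unit entry falls either in the leading block, giving [v0], or among the
     nodes. *)
  - case: (split_ordP i) vi1 => j ->; last by right; exists j.
    by rewrite (ord1 j); left.
  - by rewrite -(pencil_residual_row0 _ _ _ z lambda).
  - by move=> k; rewrite -(pencil_residual_rowS _ _ w).
move=> k; rewrite !mxE eqxx /= opprB addrC subrK.
have [_|_] := eqVneq k m; first by rewrite mulr1.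
by rewrite mulr0 modulus0 mulr_ge0 // ltW.
Qed.
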